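(* Let $M$ be a Riemannian manifold of dimension $m$, $\Omega\subset M$ a domain, $\epsilon>0$, $p>1$, and let $u_\epsilon$ be a solution on $\Omega$ of $$\mathrm{div}\left(\left(|\nabla u_\epsilon|^2+\epsilon\right)^{\frac{p-2}{2}}\nabla u_\epsilon\right)=0.$$ Then the Hessian $\nabla du_\epsilon$ of $u_\epsilon$ satisfies $$\left(|du_\epsilon|^2+\epsilon\right)|\nabla du_\epsilon|^2\ \ge\ \frac{1+\kappa_2}{4}\left|\nabla|du_\epsilon|^2\right|^2$$ at every $x\in\Omega$, where $\kappa_2=\min\left\{\frac{(p-1)^2}{m},1\right\}$.
   Context: Solutions $u_\epsilon$ are $C^\infty$ on $\Omega$ (the equation is nondegenerate). $|\nabla du_\epsilon|$ is the Hilbert–Schmidt norm of the Hessian. *)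

(* Defs.v *)
From HB Require Import structures.
From mathcomp Require Import all_boot all_order all_algebra.
From mathcomp Require Import all_classical all_reals all_analysis.
Import numFieldNormedType.Exports.

Set Implicit Arguments.
Unset Strict Implicit.
Unset Printing Implicit Defensive.

Local Open Scope classical_set_scope.
Local Open Scope ring_scope.

(** * Smooth functions on open subsets of [R^m] *)

Definition iter_partial (R : realType) (m : nat) (s : seq 'I_m)
    (f : 'rV[R]_m -> R) : 'rV[R]_m -> R :=
  foldr (fun i h y => 'D_('e_i) h y) f s.

(** [C^oo] on [U]: all iterated partial derivatives, in any order, exist and
    are continuous at the points of [U].  Only used with [U] open, so that the
    values of [f] outside [U] are irrelevant. *)
Definition smooth_on (R : realType) (m : nat) (U : set 'rV[R]_m)
    (f : 'rV[R]_m -> R) : Prop :=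
  forall (s : seq 'I_m) (y : 'rV[R]_m), U y ->
    {for y, continuous (iter_partial s f)} /\
    (forall i : 'I_m, derivable (iter_partial s f) y 'e_i).

(** * Smooth manifolds *)

(** [chart_map] and [chart_inv] are total functions, constrained only on
    [chart_dom] and on its image. *)
Record chart (R : realType) (m : nat) (M : topologicalType) := Chart {
  chart_dom : set M;
  chart_map : M -> 'rV[R]_m;
  chart_inv : 'rV[R]_m -> M;
  chart_dom_open : open chart_dom;
  chart_img_open : open (chart_map @` chart_dom);
  chart_mapK : forall x : M, chart_dom x -> chart_inv (chart_map x) = x;
  chart_map_continuous : {within chart_dom, continuous chart_map};
  chart_inv_continuous :
    {within chart_map @` chart_dom, continuous chart_inv}
}.

Record smooth_manifold (R : realType) (m : nat) (M : topologicalType) :=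
  SmoothManifold {
  atlas : set (chart R m M);
  manifold_hausdorff : hausdorff_space M;
  manifold_second_countable : @second_countable M;
  atlas_cover : forall x : M, exists2 a, atlas a & chart_dom a x;
  atlas_compatible : forall (a b : chart R m M) (j : 'I_m),
    atlas a -> atlas b ->
    smooth_on (chart_map a @` (chart_dom a `&` chart_dom b))
      (fun y => chart_map b (chart_inv a y) 0 j)
}.

(** [pderiv a f x i] is the derivative at [x] of [f : M -> R] along the
    [i]-th coordinate vector field of the chart [a]. *)
Definition pderiv (R : realType) (m : nat) (M : topologicalType)
    (a : chart R m M) (f : M -> R) (x : M) (i : 'I_m) : R :=
  'D_('e_i) (f \o chart_inv a) (chart_map a x).

(** Entry [(i, k)] is the [i]-th partial derivative, in the chart [a], of the
    [k]-th coordinate of [b]. *)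
Definition transition_jacobian (R : realType) (m : nat) (M : topologicalType)
    (a b : chart R m M) (x : M) : 'M[R]_m :=
  \matrix_(i < m, k < m) pderiv a (fun z => chart_map b z 0 k) x i.

Definition smooth_fun_on (R : realType) (m : nat) (M : topologicalType)
    (X : smooth_manifold R m M) (D : set M) (f : M -> R) : Prop :=
  forall a : chart R m M, atlas X a ->
    smooth_on (chart_map a @` (chart_dom a `&` D)) (f \o chart_inv a).

(** * Riemannian manifolds *)

(** The metric is a smooth, symmetric, positive definite covariant 2-tensor
    field: [metric a x] is its matrix [g_ij] at [x] in the coordinates of [a],
    and [metric_change] is the tensor transformation law. *)
Record riemannian_manifold (R : realType) (m : nat) (M : topologicalType) :=
  RiemannianManifold {
  riemannian_smooth :> smooth_manifold R m M;
  metric : chart R m M -> M -> 'M[R]_m;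
  metric_smooth : forall (a : chart R m M) (i j : 'I_m),
    atlas riemannian_smooth a ->
    smooth_on (chart_map a @` chart_dom a)
      (fun y => metric a (chart_inv a y) i j);
  metric_sym : forall (a : chart R m M) (x : M),
    atlas riemannian_smooth a -> chart_dom a x ->
    (metric a x)^T = metric a x;
  metric_posdef : forall (a : chart R m M) (x : M) (v : 'rV[R]_m),
    atlas riemannian_smooth a -> chart_dom a x -> v != 0 ->
    0 < (v *m metric a x *m v^T) 0 0;
  metric_change : forall (a b : chart R m M) (x : M),
    atlas riemannian_smooth a -> atlas riemannian_smooth b ->
    chart_dom a x -> chart_dom b x ->
    metric a x = transition_jacobian a b x *m metric b x
                   *m (transition_jacobian a b x)^T
}.

(** * Riemannian calculus in a chart

    Vector fields and 1-forms are given by the row of their components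
    ([X^j], resp. [w_j]) in the coordinate frame, resp. coframe, of [a]. *)

Definition differential (R : realType) (m : nat) (M : topologicalType)
    (a : chart R m M) (f : M -> R) (x : M) : 'rV[R]_m :=
  \row_j pderiv a f x j.

Definition gradient (R : realType) (m : nat) (M : topologicalType)
    (g : riemannian_manifold R m M) (a : chart R m M) (f : M -> R) (x : M) :
    'rV[R]_m :=
  \row_j \sum_i invmx (metric g a x) j i * differential a f x 0 i.

Definition vec_sqnorm (R : realType) (m : nat) (M : topologicalType)
    (g : riemannian_manifold R m M) (a : chart R m M) (x : M)
    (v : 'rV[R]_m) : R :=
  \sum_i \sum_j metric g a x i j * v 0 i * v 0 j.

Definition covec_sqnorm (R : realType) (m : nat) (M : topologicalType)
    (g : riemannian_manifold R m M) (a : chart R m M) (x : M)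
    (w : 'rV[R]_m) : R :=
  \sum_i \sum_j invmx (metric g a x) i j * w 0 i * w 0 j.

(** Squared Hilbert-Schmidt norm of a bilinear form with matrix [T]. *)
Definition bilin_sqnorm (R : realType) (m : nat) (M : topologicalType)
    (g : riemannian_manifold R m M) (a : chart R m M) (x : M)
    (T : 'M[R]_m) : R :=
  \sum_i \sum_j \sum_k \sum_l
    invmx (metric g a x) i k * invmx (metric g a x) j l * T i j * T k l.

(** The Christoffel symbol [Gamma^k_ij] of the Levi-Civita connection. *)
Definition christoffel (R : realType) (m : nat) (M : topologicalType)
    (g : riemannian_manifold R m M) (a : chart R m M) (x : M)
    (k i j : 'I_m) : R :=
  2^-1 * \sum_l invmx (metric g a x) k l *
    (pderiv a (fun z => metric g a z j l) x i
     + pderiv a (fun z => metric g a z i l) x j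
     - pderiv a (fun z => metric g a z i j) x l).

(** [(nabla X)_i^j] *)
Definition covariant_vec (R : realType) (m : nat) (M : topologicalType)
    (g : riemannian_manifold R m M) (a : chart R m M) (X : M -> 'rV[R]_m)
    (x : M) : 'M[R]_m :=
  \matrix_(i < m, j < m)
    (pderiv a (fun z => X z 0 j) x i
     + \sum_k christoffel g a x j i k * X x 0 k).

(** [(nabla w)_ij] *)
Definition covariant_form (R : realType) (m : nat) (M : topologicalType)
    (g : riemannian_manifold R m M) (a : chart R m M) (w : M -> 'rV[R]_m)
    (x : M) : 'M[R]_m :=
  \matrix_(i < m, j < m)
    (pderiv a (fun z => w z 0 j) x i
     - \sum_k christoffel g a x k i j * w x 0 k).

Definition divergence (R : realType) (m : nat) (M : topologicalType)
    (g : riemannian_manifold R m M) (a : chart R m M) (X : M -> 'rV[R]_m)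
    (x : M) : R :=
  \tr (covariant_vec g a X x).

Definition hessian (R : realType) (m : nat) (M : topologicalType)
    (g : riemannian_manifold R m M) (a : chart R m M) (f : M -> R) (x : M) :
    'M[R]_m :=
  covariant_form g a (differential a f) x.

(** * The regularized p-harmonic equation *)

Definition domain (M : topologicalType) (D : set M) : Prop :=
  [/\ open D, connected D & D !=set0].

(** The equation is an identity between functions on [D]; it is tested at each
    point in every chart of the atlas around that point. *)
Definition regularized_solution (R : realType) (m : nat) (M : topologicalType)
    (g : riemannian_manifold R m M) (D : set M) (eps p : R) (u : M -> R) :
    Prop :=
  smooth_fun_on g D u /\
  forall (a : chart R m M) (x : M), atlas g a -> chart_dom a x -> D x ->
    divergence g a
      (fun z => (vec_sqnorm g a z (gradient g a u z) + eps) `^ ((p - 2) / 2)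
                  *: gradient g a u z) x = 0.

Definition kappa2 (R : realType) (m : nat) (p : R) : R :=
  Num.min ((p - 1) ^+ 2 / m%:R) 1.

(* Main.v *)
(* Expanding the divergence gives [(|du|^2 + eps) tr H + (p - 2) H(v,v) = 0]
   for [v] the gradient and [H] the Hessian, and [grad |du|^2 = 2 H v].  Split
   [H] at a point along [n = v/|v|] and its complement: the diagonal entry
   [H(n,n)], the mixed entries, which count twice in [|H|^2] since [H] is
   symmetric, and the complementary block, whose squared norm is at least
   [1/m] times its squared trace, known from the equation.  With
   [t = |du|^2 / (|du|^2 + eps)] that trace is [- (1 + (p - 2) t) H(n,n)], and
   [1 + (p - 2) t >= (p - 1) t] yields [1 + kappa2 t^2] times [|H n|^2]; finally
   [1 + kappa2 t^2 >= t (1 + kappa2)] because [(1 - t) (1 - kappa2 t) >= 0]. *)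
Require Import Defs.
From HB Require Import structures.
From mathcomp Require Import all_boot all_order all_algebra.
From mathcomp Require Import all_classical all_reals all_analysis.
From mathcomp Require Import ring lra.
Import numFieldNormedType.Exports.
Local Open Scope classical_set_scope.
Local Open Scope ring_scope.
Set Implicit Arguments.
Unset Strict Implicit.
Unset Printing Implicit Defensive.
Import Order.TTheory GRing.Theory Num.Theory.

(** * The inequality in Euclidean coordinates *)

Lemma mxtrace_mul_tr_ge0 (R : realDomainType) (m n : nat) (A : 'M[R]_(m, n)) :
  0 <= \tr (A *m A^T).
Proof.
rewrite /mxtrace sumr_ge0 // => i _; rewrite mxE sumr_ge0 // => j _.
by rewrite mxE -expr2 sqr_ge0.
Qed.

(** The squared norm of [m A - (\tr A) I] is nonnegative and expands to [m (m N - t ^+ 2)], with [N]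
    the squared norm and [t] the trace of [A]. The factor [m] cancels only when positive, so size 0
    is treated apart. *)
Lemma sqr_mxtrace_le (R : realDomainType) (m : nat) (A : 'M[R]_m) :
  (\tr A) ^+ 2 <= m%:R * \tr (A *m A^T).
Proof.
case: m A => [|m] A; first by rewrite /mxtrace big_ord0 expr0n mul0r.
have := mxtrace_mul_tr_ge0 (m.+1%:R *: A - (\tr A)%:M).
rewrite linearB /= linearZ /= tr_scalar_mx mulmxBl !mulmxBr.
rewrite -!scalemxAl -!scalemxAr !mul_mx_scalar mul_scalar_mx.
rewrite !linearB /= !linearZ /= mxtrace_tr mxtrace_scalar.
set t := \tr A; set N := \tr _.
have m0R : 0 < m.+1%:R :> R by rewrite ltr0n.
rewrite -[_ *+ m.+1]mulr_natl => h.
have : 0 <= m.+1%:R * (m.+1%:R * N - t ^+ 2).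
  by apply: le_trans h _; rewrite le_eqVlt; apply/orP; left; apply/eqP; ring.
by rewrite pmulr_rge0 // subr_ge0 mulr1.
Qed.

(* With [P = F - w^T w] (which satisfies [P^2 = F P]), [P H P] is [F^2] times
   the restriction of [H] to the orthogonal complement of [w]; the inequality
   is Cauchy-Schwarz for the trace of [P H P]. *)
Lemma projected_trace_le (R : realFieldType) (m : nat) (H : 'M[R]_m)
    (w : 'rV[R]_m) (F := (w *m w^T) 0 0) (a := (w *m H *m w^T) 0 0)
    (b := (w *m H *m H *m w^T) 0 0) :
  H^T = H -> 0 < F ->
  (F * \tr H - a) ^+ 2 <= m%:R * (F ^+ 2 * \tr (H *m H) - 2 * F * b + a ^+ 2).
Proof.
move=> Hs F0.
pose W := w^T *m w; pose P := F%:M - W.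
have wwE : w *m w^T = F%:M by rewrite [LHS]mx11_scalar.
have WW : W *m W = F *: W.
  by rewrite /W mulmxA -[w^T *m w *m w^T]mulmxA wwE mul_mx_scalar scalemxAl.
have Ps : P^T = P by rewrite linearB /= tr_scalar_mx trmx_mul trmxK.
have PP : P *m P = F *: P.
  rewrite /P mulmxBl !mulmxBr mul_mx_scalar WW !mul_scalar_mx.
  by rewrite mul_mx_scalar scalerBr subrr subr0.
have trW (A : 'M[R]_m) : \tr (W *m A) = (w *m A *m w^T) 0 0.
  by rewrite /W -mulmxA mxtrace_mulC trace_mx11.
have trPH : \tr (P *m H) = F * \tr H - a.
  by rewrite mulmxBl linearB /= mul_scalar_mx linearZ /= trW.
have trT : \tr (P *m H *m P) = F * (F * \tr H - a).
  by rewrite mxtrace_mulC mulmxA PP -scalemxAl linearZ /= trPH.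
(* Cyclicity of the trace and [P^2 = F P] reduce this to [F ^+ 2] times [\tr (P H P H)], which is
   expanded through [P = F - W]. *)
have trTT : \tr (P *m H *m P *m (P *m H *m P)^T)
    = F ^+ 2 * (F ^+ 2 * \tr (H *m H) - 2 * F * b + a ^+ 2).
  rewrite !trmx_mul Hs Ps.
  have -> : P *m H *m P *m (P *m (H *m P)) = F *: (P *m H *m (P *m H) *m P).
    by rewrite !mulmxA -[P *m H *m P *m P]mulmxA PP -!(scalemxAl,scalemxAr).
  rewrite linearZ /= mxtrace_mulC !mulmxA PP -!scalemxAl linearZ /=.
  rewrite -[P *m H *m P *m H]mulmxA /P mulmxBl mul_scalar_mx mulmxBl !mulmxBr.
  rewrite -!(scalemxAl,scalemxAr) !linearB /= !linearZ /=.
  rewrite [\tr (H *m (W *m H))]mxtrace_mulC -![W *m H *m _]mulmxA.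
  rewrite !trW.
  have -> : (w *m (H *m (W *m H)) *m w^T) 0 0 = a ^+ 2.
    have -> : w *m (H *m (W *m H)) *m w^T = (w *m H *m w^T) *m (w *m H *m w^T).
      by rewrite /W !mulmxA.
    by rewrite mxE big_ord1 -expr2.
  rewrite [w *m (H *m H)]mulmxA -/b /GRing.scale /=; ring.
have := sqr_mxtrace_le (P *m H *m P).
rewrite trT trTT exprMn [leRHS]mulrCA ler_pM2l //; exact: exprn_gt0.
Qed.

(** Cauchy-Schwarz for [w] and [w H]: the squared norm of [F (w H) - a w] equals
    [F (F b - a ^+ 2)]. *)
Lemma sqr_quadform_le (R : realFieldType) (m : nat) (H : 'M[R]_m)
    (w : 'rV[R]_m) (F := (w *m w^T) 0 0) (a := (w *m H *m w^T) 0 0)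
    (b := (w *m H *m H *m w^T) 0 0) :
  H^T = H -> 0 < F -> a ^+ 2 <= F * b.
Proof.
move=> Hs F0.
have := mxtrace_mul_tr_ge0 (F *: (w *m H) - a *: w).
rewrite linearB /= [(F *: _)^T]linearZ [(a *: _)^T]linearZ /= trmx_mul Hs.
rewrite mulmxBl !mulmxBr -!scalemxAl -!scalemxAr !linearB /=.
rewrite !mxtraceZ !trace_mx11.
rewrite [w *m H *m (H *m _)]mulmxA [w *m (H *m _)]mulmxA -/a -/b -/F.
move=> h; have : 0 <= F * (F * b - a ^+ 2).
  by apply: le_trans h _; rewrite le_eqVlt; apply/orP; left; apply/eqP; ring.
by rewrite pmulr_rge0 // subr_ge0.
Qed.

Lemma kappa2_le1 (R : realType) (m : nat) (p : R) : kappa2 m p <= 1.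
Proof. by rewrite /kappa2 ge_min lexx orbT. Qed.

Lemma kappa2_ge0 (R : realType) (m : nat) (p : R) : 0 <= kappa2 m p.
Proof. by rewrite /kappa2 le_min ler01 andbT divr_ge0 // sqr_ge0. Qed.

Lemma kappa2_natM_le (R : realType) (m : nat) (p : R) :
  m%:R * kappa2 m p <= (p - 1) ^+ 2.
Proof.
have [->|m0] := posnP m; first by rewrite mul0r sqr_ge0.
by rewrite mulrC -ler_pdivlMr ?ltr0n // /kappa2 ge_min lexx.
Qed.

(* [t], [N] stand for the trace and the squared norm of the Hessian, [a], [b]
   for [H(w,w)] and [|Hw|^2]; the last step is [(E - F) (E - k F) >= 0]. *)
Lemma scalar_hessian_bound (R : realFieldType) (M p F E t a b N k : R) :
  0 < M -> 1 < p -> 0 < F -> F <= E -> 0 <= k -> k <= 1 ->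
  M * k <= (p - 1) ^+ 2 -> E * t + (p - 2) * a = 0 ->
  a ^+ 2 <= F * b ->
  (F * t - a) ^+ 2 <= M * (F ^+ 2 * N - 2 * F * b + a ^+ 2) ->
  (1 + k) * b <= E * N.
Proof.
move=> M0 p1 F0 FE k0 k1 km heq h2 h1.
have E0 : 0 < E by exact: lt_le_trans FE.
(* The trace of the complementary block, cleared of denominators by [E]; the equation eliminates
   [t]. *)
have tE : E * (F * t - a) = - (E + (p - 2) * F) * a.
  by rewrite mulrBr mulrCA (_ : E * t = - ((p - 2) * a)); [ring | lra].
have pF0 : 0 <= (p - 1) * F by rewrite mulr_ge0 ?ltW // subr_gt0.
(* This is [F <= E] shifted by [(p - 2) * F], which avoids a case split on the sign of [p - 2]. *)
have pFE : (p - 1) * F <= E + (p - 2) * F by lra.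
have h3 : k * F ^+ 2 * a ^+ 2 <= E ^+ 2 * (F ^+ 2 * N - 2 * F * b + a ^+ 2).
  rewrite -(ler_pM2l M0).
  have : ((p - 1) * F) ^+ 2 * a ^+ 2 <= (E * (F * t - a)) ^+ 2.
    rewrite tE [leRHS]exprMn sqrrN ler_wpM2r ?sqr_ge0 //.
    by rewrite ler_pXn2r ?nnegrE // (le_trans pF0).
  have : M * k * (F ^+ 2 * a ^+ 2) <= (p - 1) ^+ 2 * (F ^+ 2 * a ^+ 2).
    by rewrite ler_wpM2r // mulr_ge0 ?sqr_ge0.
  have : E ^+ 2 * (F * t - a) ^+ 2 <=
      E ^+ 2 * (M * (F ^+ 2 * N - 2 * F * b + a ^+ 2)).
    by rewrite ler_wpM2l // sqr_ge0.
  rewrite !exprMn; lra.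
(* Nonnegativity of [E ^+ 2 - k * F ^+ 2] allows [a ^+ 2] to be replaced by its upper bound [F * b]
   in [h3]; this gives [h5]. *)
have kFE : k * F ^+ 2 <= E ^+ 2.
  apply: le_trans (_ : F ^+ 2 <= _); first by rewrite ler_piMl // sqr_ge0.
  by rewrite ler_pXn2r ?nnegrE // ltW.
have h4 : (E ^+ 2 - k * F ^+ 2) * a ^+ 2 <= (E ^+ 2 - k * F ^+ 2) * (F * b).
  by rewrite ler_wpM2l // subr_ge0.
have h5 : (E ^+ 2 + k * F ^+ 2) * b <= E ^+ 2 * F * N.
  by rewrite -(ler_pM2l F0); lra.
have b0 : 0 <= b by rewrite -(pmulr_rge0 _ F0); apply: le_trans h2; exact: sqr_ge0.
have h6 : E * F * ((1 + k) * b) <= (E ^+ 2 + k * F ^+ 2) * b.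
  rewrite mulrA ler_wpM2r //.
  have kFE1 : k * F <= E by apply: le_trans FE; rewrite ler_piMl // ltW.
  have : 0 <= (E - F) * (E - k * F) by rewrite mulr_ge0 // subr_ge0.
  lra.
have := le_trans h6 h5; rewrite (_ : E ^+ 2 * F * N = E * F * (E * N)).
  by rewrite ler_pM2l // mulr_gt0.
by ring.
Qed.

Lemma euclidean_hessian_bound (R : realType) (m : nat) (p eps : R)
    (H : 'M[R]_m) (w : 'rV[R]_m) (F := (w *m w^T) 0 0)
    (a := (w *m H *m w^T) 0 0) (b := (w *m H *m H *m w^T) 0 0) :
  H^T = H -> 0 < eps -> 1 < p ->
  (F + eps) * \tr H + (p - 2) * a = 0 ->
  (1 + kappa2 m p) * b <= (F + eps) * \tr (H *m H).
Proof.
move=> Hs eps0 p1 heq.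
have N0 : 0 <= \tr (H *m H) by have := mxtrace_mul_tr_ge0 H; rewrite Hs.
have F0 : 0 <= F by have := mxtrace_mul_tr_ge0 w; rewrite trace_mx11.
(* The projection argument divides by [F]. When [F] vanishes so does [w], hence [b], and only the
   sign of the right side matters. *)
have := F0; rewrite le_eqVlt => /orP[/eqP F00|Fp].
  have w0 : w = 0.
    apply/rowP => i; rewrite mxE; apply/eqP.
    have /eqP := esym F00; rewrite /F mxE psumr_eq0; last first.
      by move=> j _; rewrite mxE -expr2 sqr_ge0.
    by move=> /allP/(_ i (mem_index_enum _)); rewrite mxE -expr2 sqrf_eq0.
  rewrite /b w0 !mul0mx mxE mulr0; apply: mulr_ge0 => //.
  by rewrite addr_ge0 // ltW.
have m0 : (0 < m)%N.
  rewrite lt0n; apply/negP => /eqP m0; move: Fp; rewrite /F mxE big1 ?ltxx //.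
  by move=> i; have := ltn_ord i; rewrite {2}m0.
apply: scalar_hessian_bound heq (sqr_quadform_le Hs Fp) (projected_trace_le Hs Fp).
all: rewrite ?ltr0n ?kappa2_ge0 ?kappa2_le1 ?kappa2_natM_le //.
by rewrite lerDl ltW.
Qed.

(** * Arbitrary inner products *)

Definition posdef (R : numDomainType) (n : nat) (G : 'M[R]_n) : Prop :=
  forall v : 'rV[R]_n, v != 0 -> 0 < (v *m G *m v^T) 0 0.

Lemma posdef_unitmx (R : numFieldType) (n : nat) (G : 'M[R]_n) :
  posdef G -> G \in unitmx.
Proof.
move=> Gpos; rewrite -row_free_unit -kermx_eq0; apply/rowV0P => v /sub_kermxP vG.
apply/eqP/negP => /negP /Gpos.
by rewrite vG mul0mx mxE ltxx.
Qed.

(** Induction on the size: completing the square in the first coordinate leaves the Schur complement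
    of the corner entry, again symmetric and positive definite. *)
Lemma cholesky (R : rcfType) (n : nat) (G : 'M[R]_n) :
  G^T = G -> posdef G -> exists S : 'M[R]_n, G = S *m S^T.
Proof.
elim: n G => [|n IHn] G Gs Gpos.
  by exists 0; apply/matrixP; case.
change 'M[R]_(1 + n) in G.
pose a := G 0 0; pose b := ursubmx G; pose C := drsubmx G.
have GE : G = block_mx a%:M b b^T C.
  rewrite -[LHS]submxK -/b -/C; congr block_mx.
    by rewrite [LHS]mx11_scalar !mxE (_ : lshift n 0 = 0) //; apply/val_inj.
  by rewrite -{1}Gs trmx_ursub.
have quad (x : 'M[R]_1) (v : 'rV[R]_n) : row_mx x v *m G *m (row_mx x v)^T =
    a *: (x *m x^T) + v *m b^T *m x^T + (x *m b *m v^T + v *m C *m v^T).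
  rewrite GE mul_row_block tr_row_mx mul_row_col !mulmxDl mul_mx_scalar.
  by rewrite scalemxAl.
have a0 : 0 < a.
  have /Gpos : row_mx 1%:M 0 != 0 :> 'rV[R]_(1 + n).
    by rewrite row_mx_eq0 negb_and; apply/orP; left; exact: oner_neq0.
  rewrite quad trmx0 !mulmx0 !mul0mx trmx1 mul1mx !addr0 mxE.
  by rewrite mxE mulr1.
have an0 : a != 0 by rewrite gt_eqF.
pose C' := C - a^-1 *: (b^T *m b).
have C's : C'^T = C'.
  by rewrite /C' linearB linearZ /= trmx_mul trmxK /C trmx_drsub Gs.
have C'pos : posdef C'.
  (* This [x] minimizes the quadratic form of [G] over the first coordinate; the minimum is the form
     of the Schur complement at [v]. *)
  move=> v v0; pose x : 'M[R]_1 := - a^-1 *: (v *m b^T).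
  have /Gpos : row_mx x v != 0 by rewrite row_mx_eq0 negb_and v0 orbT.
  rewrite quad; suff -> : a *: (x *m x^T) + v *m b^T *m x^T +
    (x *m b *m v^T + v *m C *m v^T) = v *m C' *m v^T by [].
  have xT : x^T = - a^-1 *: (b *m v^T) by rewrite linearZ /= trmx_mul trmxK.
  rewrite xT /C' mulmxBr mulmxBl -scalemxAr -!scalemxAl /x.
  rewrite -!(scalemxAl, scalemxAr) !mulmxA !scalerA.
  by rewrite mulrNN mulVKf // !scaleNr subrr add0r addrC.
have [S SS] := IHn _ C's C'pos.
pose L : 'M[R]_(1 + n) :=
  block_mx (Num.sqrt a)%:M 0 ((Num.sqrt a)^-1 *: b^T) S.
suff LL : G = L *m L^T by exists L.
have sa0 : Num.sqrt a != 0 by rewrite sqrtr_eq0 -ltNge.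
rewrite {1}GE /L tr_block_mx mulmx_block !trmx0 !mulmx0 !mul0mx !addr0.
rewrite tr_scalar_mx linearZ /= trmxK -!(scalemxAl, scalemxAr) scalerA.
rewrite !mul_scalar_mx mul_mx_scalar !scalerA mulVf // !scale1r.
rewrite scale_scalar_mx -invfM -!expr2 sqr_sqrtr ?ltW // -SS /C'.
by rewrite addrC subrK.
Qed.

(** For [G = S S^T] the matrix [Q] is [invmx S]; its rows form a basis orthonormal for [G]. *)
Lemma invmx_factor (R : rcfType) (n : nat) (G : 'M[R]_n) :
  G^T = G -> posdef G -> exists Q : 'M[R]_n, invmx G = Q^T *m Q.
Proof.
move=> Gs Gpos; have [S GE] := cholesky Gs Gpos.
have Gu := posdef_unitmx Gpos.
have /andP[Su Stu] : (S \in unitmx) && (S^T \in unitmx).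
  by rewrite -unitmx_mul -GE.
exists (invmx S); rewrite -[RHS](mulKmx Gu) GE trmx_inv !mulmxA.
by rewrite !mulmxK.
Qed.

Lemma invmx_sym (R : comUnitRingType) (n : nat) (G : 'M[R]_n) :
  G^T = G -> (invmx G)^T = invmx G.
Proof. by move=> Gs; rewrite trmx_inv Gs. Qed.

(** Passage to an orthonormal frame: with [K = Q^T Q], the Euclidean bound is applied to [Q H Q^T]
    and [w Q^T], whose traces and quadratic forms are the contractions by [K]. *)
Lemma metric_hessian_bound (R : realType) (m : nat) (p eps : R)
    (G H : 'M[R]_m) (w : 'rV[R]_m) (K := invmx G) (v := w *m K)
    (F := (w *m K *m w^T) 0 0) :
  G^T = G -> posdef G -> H^T = H -> 0 < eps -> 1 < p ->
  (F + eps) * \tr (K *m H) + (p - 2) * (v *m H *m v^T) 0 0 = 0 ->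
  (1 + kappa2 m p) * (v *m H *m K *m H *m v^T) 0 0
    <= (F + eps) * \tr (K *m H *m K *m H).
Proof.
move=> Gs Gpos Hs eps0 p1; have [Q KE] := invmx_factor Gs Gpos.
have vT : v^T = K *m w^T by rewrite trmx_mul invmx_sym.
have trE (A : 'M[R]_m) : \tr (Q *m A *m Q^T) = \tr (K *m A).
  by rewrite mxtrace_mulC mulmxA -KE.
have H's : (Q *m H *m Q^T)^T = Q *m H *m Q^T.
  by rewrite !trmx_mul trmxK Hs mulmxA.
have := euclidean_hessian_bound (w := w *m Q^T) H's eps0 p1.
rewrite /F vT /v !mulmxA trmx_mul trmxK !mulmxA trE.
have -> : Q *m H *m Q^T *m Q *m H *m Q^T = Q *m (H *m K *m H) *m Q^T.
  by rewrite /K KE !mulmxA.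
by rewrite trE /K KE !mulmxA.
Qed.

(** * Chart formulas at a point *)

Lemma mul_rV_mx_trE (R : pzSemiRingType) (m : nat) (v w : 'rV[R]_m) (A : 'M[R]_m) :
  (v *m A *m w^T) 0 0 = \sum_i \sum_j v 0 i * A i j * w 0 j.
Proof.
rewrite mxE exchange_big /=; apply: eq_bigr => j _.
by rewrite !mxE mulr_suml.
Qed.

Lemma mxtrace_mulmxE (R : pzSemiRingType) (m : nat) (A B : 'M[R]_m) :
  \tr (A *m B) = \sum_i \sum_j A i j * B j i.
Proof. by apply: eq_bigr => i _; rewrite mxE. Qed.

(* The chart formulas at a point: [K] is the inverse metric, [dG i] the matrix
   of the [i]-th partial derivatives of the metric, [D i j] the second partial
   derivatives and [w] the differential of the function. *)
Section CoordinateAlgebra.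
Variables (R : numFieldType) (m : nat) (K : 'M[R]_m) (dG : 'I_m -> 'M[R]_m).
Variables (D : 'M[R]_m) (w : 'rV[R]_m).
Hypothesis Ks : K^T = K.
Hypothesis dGs : forall i, (dG i)^T = dG i.

Definition chart_christoffel (k i j : 'I_m) : R :=
  2^-1 * \sum_l K k l * (dG i j l + dG j i l - dG l i j).

Definition chart_hessian : 'M[R]_m :=
  \matrix_(i, j) (D i j - \sum_k chart_christoffel k i j * w 0 k).

Let v := w *m K.

Let Kij i j : K i j = K j i. Proof. by rewrite -{1}Ks mxE. Qed.
Let dGij k i j : dG k i j = dG k j i. Proof. by rewrite -{1}dGs mxE. Qed.

(** Contracting the upper index of the Christoffel symbol with [w] raises the index of [w], so only
    the gradient [v] remains. *)
Lemma chart_hessianE (i j : 'I_m) :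
  chart_hessian i j =
  D i j - 2^-1 * \sum_l v 0 l * (dG i j l + dG j i l - dG l i j).
Proof.
rewrite mxE; congr (_ - _).
under eq_bigr do rewrite /chart_christoffel -mulrA mulr_suml.
rewrite -mulr_sumr exchange_big /=; congr (_ * _); apply: eq_bigr => l _.
rewrite mxE mulr_suml; apply: eq_bigr => k _.
by rewrite mulrAC [K k l * _]mulrC.
Qed.

(** The Christoffel symbols are symmetric in their lower indices: the connection is torsion-free. *)
Lemma chart_hessian_sym : D^T = D -> chart_hessian^T = chart_hessian.
Proof.
move=> Ds; apply/matrixP => i j; rewrite mxE !chart_hessianE.
rewrite -{1}Ds mxE; congr (_ - _ * _); apply: eq_bigr => l _.
by rewrite [dG j i l + _]addrC [dG l j i]dGij.
Qed.

(** Coordinate form of [d|du|^2 = 2 H(grad u, .)]: the left side is the product rule for [w K w^T]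
    in direction [k], with [- K (dG k) K] the derivative of the inverse metric. *)
Lemma chart_derive_sqnorm (k : 'I_m) :
  ((row k D *m K + w *m (- (K *m dG k *m K))) *m w^T
     + w *m K *m (row k D)^T) 0 0
  = 2 * (v *m chart_hessian^T) 0 k.
Proof.
have vT : v^T = K *m w^T by rewrite trmx_mul Ks.
have -> : (row k D *m K + w *m (- (K *m dG k *m K))) *m w^T
    + w *m K *m (row k D)^T =
    row k D *m v^T + v *m (row k D)^T - v *m dG k *m v^T.
  by rewrite mulmxDl mulmxN mulNmx vT /v !mulmxA addrAC.
have E : (row k D *m v^T) 0 0 = \sum_i v 0 i * D k i.
  by rewrite mxE; apply: eq_bigr => i _; rewrite !mxE mulrC.
have -> : (row k D *m v^T + v *m (row k D)^T - v *m dG k *m v^T) 0 0 =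
    2 * (\sum_i v 0 i * D k i) - (v *m dG k *m v^T) 0 0.
  have mxDB (A B C : 'M[R]_1) : (A + B - C) 0 0 = A 0 0 + B 0 0 - C 0 0.
    by rewrite !mxE.
  rewrite mxDB E mulr2n mulrDl mul1r; congr (_ + _ - _).
  by rewrite mxE; apply: eq_bigr => i _; rewrite !mxE.
rewrite [in RHS]mxE.
under [in RHS]eq_bigr do
  rewrite [_^T _ _]mxE chart_hessianE mulrBr mulrCA mulr_sumr.
rewrite sumrB mulrBr -mulr_sumr mulrA divff ?pnatr_eq0 // mul1r.
congr (_ - _); rewrite mul_rV_mx_trE.
under [RHS]eq_bigr do under eq_bigr do rewrite !(mulrBr, mulrDr).
under [RHS]eq_bigr do rewrite sumrB big_split /=.
(* Two of the three metric terms differ only by exchanging the summation indices and cancel; the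
   third is [v (dG k) v^T]. *)
rewrite sumrB big_split /= -addrA [X in _ + (_ - X)]exchange_big /=.
rewrite [X in _ + X](_ : _ = 0) ?addr0.
  by apply: eq_bigr => i _; apply: eq_bigr => l _; rewrite -mulrA [X in _ * X]mulrC.
apply/eqP; rewrite subr_eq0; apply/eqP.
by apply: eq_bigr => i _; apply: eq_bigr => l _; rewrite mulrCA.
Qed.

(** The divergence of the gradient is the metric trace of the Hessian; the left side is the
    coordinate divergence of [w K] after the product rule. *)
Lemma chart_divergence :
  \sum_i ((row i D *m K + w *m (- (K *m dG i *m K))) 0 i
          + \sum_k chart_christoffel i i k * v 0 k)
  = \tr (K *m chart_hessian).
Proof.
(* Two contractions of [dG] with [K] and [v] occur: differentiating the inverse metric yields
   [- A1], the traced Christoffel symbol yields [A2 / 2], and the Hessian yields both. *)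
pose A1 := \sum_i \sum_j \sum_l K i j * dG i j l * v 0 l.
pose A2 := \sum_i \sum_j \sum_l K i j * dG l i j * v 0 l.
have trH : \tr (K *m chart_hessian) = \tr (K *m D) - A1 + 2^-1 * A2.
  rewrite !mxtrace_mulmxE.
  under eq_bigr do under eq_bigr do rewrite chart_hessianE mulrBr.
  under eq_bigr do rewrite sumrB.
  rewrite sumrB -addrA; congr (_ + _).
  have -> : - A1 + 2^-1 * A2 = - (2^-1 * (A1 + A1 - A2)).
    rewrite mulrBr -mulr2n -[A1 *+ 2]mulr_natl mulrA mulVf ?pnatr_eq0 // mul1r.
    by rewrite opprB addrC.
  congr (- _).
  have {1}-> : A1 = \sum_i \sum_j \sum_l K i j * dG j i l * v 0 l.
    rewrite /A1 exchange_big /=; apply: eq_bigr => i _; apply: eq_bigr => j _.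
    by rewrite [K j i]Kij.
  rewrite /A1 /A2 -big_split -sumrB mulr_sumr /=; apply: eq_bigr => i _.
  rewrite -big_split -sumrB mulr_sumr /=; apply: eq_bigr => j _.
  rewrite -big_split -sumrB mulrCA /= mulr_sumr; congr (_ * _).
  apply: eq_bigr => l _; rewrite [dG l j i]dGij -mulrDl -mulrBl -mulrDr -mulrBr.
  by rewrite -mulrA [v 0 l * _]mulrC.
rewrite trH big_split /=; congr (_ + _).
  have mxB (A B : 'rV[R]_m) i : (A - B) 0 i = A 0 i - B 0 i by rewrite !mxE.
  under eq_bigr do rewrite mulmxN mxB.
  rewrite sumrB; congr (_ - _).
    rewrite mxtrace_mulC mxtrace_mulmxE; apply: eq_bigr => i _.
    by rewrite mxE; apply: eq_bigr => j _; rewrite mxE.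
  apply: eq_bigr => i _; rewrite !mulmxA mxE; apply: eq_bigr => j _.
  rewrite mxE mulr_suml; apply: eq_bigr => l _.
  by rewrite -/v dGij [K j i]Kij mulrC mulrA mulrAC.
under eq_bigr do under eq_bigr do rewrite -mulrA.
under eq_bigr do rewrite -mulr_sumr.
rewrite -mulr_sumr; congr (_ * _).
under eq_bigr do under eq_bigr do rewrite mulr_suml.
under eq_bigr do rewrite exchange_big /=.
under eq_bigr do under eq_bigr do under eq_bigr do
  rewrite mulrBr mulrDr mulrBl mulrDl.
under eq_bigr do under eq_bigr do rewrite sumrB big_split /=.
under eq_bigr do rewrite sumrB big_split /=.
rewrite sumrB big_split /=.
(* By symmetry of [K] and [dG] the first and last Christoffel terms cancel in the trace; the middle
   one is [A2]. *)
rewrite -[RHS]add0r addrAC; congr (_ + _).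
apply/eqP; rewrite subr_eq0; apply/eqP.
rewrite [RHS]exchange_big /=; apply: eq_bigr => i _; apply: eq_bigr => j _.
by apply: eq_bigr => l _; rewrite [K j i]Kij [dG i l j]dGij.
Qed.

End CoordinateAlgebra.

(** * Symmetry of second derivatives *)

(** The two difference quotients are the same function of the increment; one-variable tools such as
    the mean value theorem thus apply along lines. *)
Lemma is_derive_line (R : numFieldType) (V W : normedModType R) (f : V -> W)
    (x v : V) (t : R) (d : W) :
  is_derive (t *: v + x) v f d -> is_derive t 1 (fun s => f (s *: v + x)) d.
Proof.
set g := fun s => _.
have E : (fun h : R => h^-1 *: ((f \o shift (t *: v + x)) (h *: v)
                         - f (t *: v + x)))
       = (fun h : R => h^-1 *: ((g \o shift t) (h *: 1) - g t)).
  by apply/funext => h; rewrite /g /= scalerDl -scalerA scale1r addrA.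
by case=> df dE; split; [move: df; rewrite /derivable E|rewrite -dE /derive E].
Qed.

(** Mean value theorem twice: in the direction [a] for the difference of [f] across the step
    [h *: b], then along [b] for ['D_a f]. *)
Lemma second_difference (R : realType) (V : normedModType R) (f : V -> R)
    (x a b : V) (h : R) : 0 < h ->
  (forall s t, 0 <= s <= h -> 0 <= t <= h ->
     derivable f (s *: a + (t *: b + x)) a /\
     derivable ('D_a f) (s *: a + (t *: b + x)) b) ->
  exists s t, [/\ 0 < s < h, 0 < t < h &
    f (h *: a + (h *: b + x)) - f (h *: a + x) - f (h *: b + x) + f x
    = h ^+ 2 * 'D_b ('D_a f) (s *: a + (t *: b + x))].
Proof.
move=> h0 df.
have h00 : 0 <= (0 : R) <= h by rewrite lexx ltW.
have hh : 0 <= h <= h by rewrite lexx ltW.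
pose g s := f (s *: a + (h *: b + x)) - f (s *: a + x).
have dg s : 0 <= s <= h ->
    is_derive s 1 g ('D_a f (s *: a + (h *: b + x)) - 'D_a f (s *: a + x)).
  move=> hs; apply: is_deriveB; apply: is_derive_line; apply: derivableP.
    exact: (df s h hs hh).1.
  by move: (df s 0 hs h00).1; rewrite scale0r add0r.
have [s] : exists2 s, s \in `]0, h[%R & g h - g 0 =
    ('D_a f (s *: a + (h *: b + x)) - 'D_a f (s *: a + x)) * (h - 0).
  apply: MVT h0 _ _ => [s /andP[s0 sh]|].
    by apply: dg; rewrite !ltW.
  apply: derivable_within_continuous => s; rewrite in_itv /= => hs.
  by have [] := dg s hs.
rewrite in_itv /= subr0 => /andP[s0 sh] gE.
have hs : 0 <= s <= h by rewrite !ltW.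
pose k t := 'D_a f (t *: b + (s *: a + x)).
have dk t : 0 <= t <= h ->
    is_derive t 1 k ('D_b ('D_a f) (s *: a + (t *: b + x))).
  move=> ht; apply: (is_derive_line (f := 'D_a f)); rewrite addrCA; apply: derivableP.
  by have [] := df s t hs ht.
have [t] : exists2 t, t \in `]0, h[%R & k h - k 0 =
    'D_b ('D_a f) (s *: a + (t *: b + x)) * (h - 0).
  apply: (@MVT _ k (fun t => 'D_b ('D_a f) (s *: a + (t *: b + x))) _ _ h0) =>
    [t /andP[t0 th]|].
    by apply: dk; rewrite !ltW.
  apply: derivable_within_continuous => t; rewrite in_itv /= => ht.
  by have [] := dk t ht.
rewrite in_itv /= subr0 => /andP[t0 th] kE.
exists s, t; rewrite s0 t0; split=> //.
move: gE kE; rewrite /g /k !scale0r !add0r [h *: b + (s *: a + x)]addrCA => gE kE.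
by rewrite expr2 mulrAC -mulrA mulrC -kE -gE; ring.
Qed.

Lemma near_ball_continuous (R : realType) (V : normedModType R) (x : V)
    (P : V -> Prop) (g1 g2 : V -> R) (e : R) : 0 < e ->
  (\forall y \near x, P y) ->
  {for x, continuous g1} -> {for x, continuous g2} ->
  exists2 r : R, 0 < r & forall y, ball x r y ->
    [/\ P y, `|g1 x - g1 y| < e & `|g2 x - g2 y| < e].
Proof.
move=> e0 /nbhs_ballP[r1 /= r10 P1] /cvgrPdist_lt/(_ e e0)/nbhs_ballP[r2 /= r20 P2].
move=> /cvgrPdist_lt/(_ e e0)/nbhs_ballP[r3 /= r30 P3].
exists (Num.min r1 (Num.min r2 r3)); first by rewrite !lt_min r10 r20.
move=> y xy; split; [apply: P1|apply: P2|apply: P3]; apply: le_ball xy.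
- by rewrite ge_min lexx.
- by rewrite !ge_min lexx orbT.
- by rewrite !ge_min lexx !orbT.
Qed.

(* Both mixed derivatives are limits of [h^-2] times the same second
   difference, which [second_difference] evaluates in the two orders. *)
Lemma mixed_derive_comm (R : realType) (V : normedModType R) (f : V -> R)
    (x a b : V) :
  (\forall y \near x, [/\ derivable f y a, derivable f y b,
     derivable ('D_a f) y b & derivable ('D_b f) y a]) ->
  {for x, continuous ('D_b ('D_a f))} -> {for x, continuous ('D_a ('D_b f))} ->
  'D_b ('D_a f) x = 'D_a ('D_b f) x.
Proof.
move=> df cab cba; apply/eqP; rewrite -subr_eq0 -normr_le0.
apply/ler_addgt0Pl => e e0; rewrite addr0.
have e20 : 0 < e / 2 by rewrite divr_gt0.
have [r r0 near_r] := near_ball_continuous e20 df cab cba.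
(* Keeps the whole parallelogram in the ball: its points are within [h (|a| + |b|) < r] of [x]. The
   added 1 keeps the denominator positive when [a] and [b] both vanish. *)
pose h := r / 2 / (`|a| + `|b| + 1).
have ab0 : 0 < `|a| + `|b| + 1 by rewrite ltr_wpDl // addr_ge0.
have h0 : 0 < h by rewrite !divr_gt0.
have hr s t : 0 <= s <= h -> 0 <= t <= h -> ball x r (s *: a + (t *: b + x)).
  move=> /andP[s0 sh] /andP[t0 th].
  rewrite -ball_normE /= addrA opprD addrCA subrr addr0 normrN.
  apply: le_lt_trans (ler_normD _ _) _; rewrite !normrZ !ger0_norm //.
  apply: le_lt_trans (_ : h * (`|a| + `|b| + 1) < r); last first.
    by rewrite divfK ?gt_eqF // gtr_pMr // invf_lt1 // ltr1n.
  rewrite !mulrDr mulr1 -[leLHS]addr0 lerD ?(ltW h0) //.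
  by rewrite lerD // ler_wpM2r.
have [s [t [hs ht E1]]] : exists s t, [/\ 0 < s < h, 0 < t < h &
    f (h *: a + (h *: b + x)) - f (h *: a + x) - f (h *: b + x) + f x
    = h ^+ 2 * 'D_b ('D_a f) (s *: a + (t *: b + x))].
  apply: second_difference h0 _ => s t hs ht.
  by case: (near_r _ (hr s t hs ht)) => -[d1 _ d2 _] _ _; exact: (conj d1 d2).
have [s' [t' [hs' ht' E2]]] : exists s t, [/\ 0 < s < h, 0 < t < h &
    f (h *: b + (h *: a + x)) - f (h *: b + x) - f (h *: a + x) + f x
    = h ^+ 2 * 'D_a ('D_b f) (s *: b + (t *: a + x))].
  apply: second_difference h0 _ => s' t' hs' ht'; rewrite addrCA.
  by case: (near_r _ (hr t' s' ht' hs')) => -[_ d1 _ d2] _ _; exact: (conj d1 d2).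
have hn0 : h ^+ 2 != 0 by rewrite expf_neq0 // gt_eqF.
have E : 'D_b ('D_a f) (s *: a + (t *: b + x)) =
    'D_a ('D_b f) (t' *: a + (s' *: b + x)).
  rewrite [RHS](congr1 ('D_a ('D_b f)) (addrCA _ _ _)).
  apply: (mulfI hn0); apply: etrans (esym E1) (etrans _ E2).
  rewrite (congr1 f (addrCA (h *: b) (h *: a) x)).
  by congr (_ + _); exact: addrAC.
have wk z : 0 < z < h -> 0 <= z <= h by case/andP=> ? ?; rewrite !ltW.
have [_ h1 _] := near_r _ (hr _ _ (wk _ hs) (wk _ ht)).
have [_ _ h2] := near_r _ (hr _ _ (wk _ ht') (wk _ hs')).
rewrite E in h1; rewrite distrC in h2.
apply: le_trans (ler_distD _ _ _) _; rewrite [e]splitr.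
exact: lerD (ltW h1) (ltW h2).
Qed.

(** * Derivatives of matrix-valued functions *)

(** At parameter 0 the transfer to the line goes both ways, so a one-variable chain rule yields a
    directional derivative. *)
Lemma is_derive_line0P (R : numFieldType) (V W : normedModType R) (f : V -> W)
    (x v : V) (d : W) :
  is_derive x v f d <-> is_derive (0 : R) 1 (fun s => f (s *: v + x)) d.
Proof.
set g := fun s => _.
have E : (fun h : R => h^-1 *: ((f \o shift x) (h *: v) - f x))
       = (fun h : R => h^-1 *: ((g \o shift 0) (h *: 1) - g 0)).
  by apply/funext => h; rewrite /g /= addr0 scale0r add0r [h *: 1]mulr1.
by split=> -[df dE]; split; rewrite -?dE /derivable /derive ?E // -E.
Qed.

Lemma is_derive_powR (R : realType) (V : normedModType R) (F : V -> R)
    (x v : V) (q d : R) : 0 < F x -> is_derive x v F d ->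
  is_derive x v (fun y => F y `^ q) (q * F x `^ (q - 1) * d).
Proof.
move=> F0 /is_derive_line0P dF; apply/is_derive_line0P.
have fx : F (0 *: v + x) = F x by rewrite scale0r add0r.
rewrite -fx in F0 *.
exact: (@is_derive1_comp _ (@powR R ^~ q) _ _ _ _ (is_derive1_powR q F0) dF).
Qed.

Lemma derivable_bigsum (R : numFieldType) (V : normedModType R) (I : Type)
    (r : seq I) (P : pred I) (F : I -> V -> R) (x v : V) :
  (forall i, derivable (F i) x v) ->
  derivable (fun y => \sum_(i <- r | P i) F i y) x v.
Proof.
move=> dF; elim: r => [|i r IHr].
  by under eq_fun do rewrite big_nil; exact: derivable_cst.
under eq_fun do rewrite big_cons.
by case: (P i); [exact: derivableD (dF i) IHr | exact: IHr].
Qed.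

Lemma derivable_bigprod (R : numFieldType) (V : normedModType R) (I : Type)
    (r : seq I) (P : pred I) (F : I -> V -> R) (x v : V) :
  (forall i, derivable (F i) x v) ->
  derivable (fun y => \prod_(i <- r | P i) F i y) x v.
Proof.
move=> dF; elim: r => [|i r IHr].
  by under eq_fun do rewrite big_nil; exact: derivable_cst.
under eq_fun do rewrite big_cons.
by case: (P i); [exact: derivableM (dF i) IHr | exact: IHr].
Qed.

Lemma derivable_det (R : numFieldType) (V : normedModType R) (n : nat)
    (A : V -> 'M[R]_n) (x v : V) :
  (forall i j, derivable (fun y => A y i j) x v) ->
  derivable (fun y => \det (A y)) x v.
Proof.
move=> dA; apply: derivable_bigsum => s.
by apply: derivableM; [exact: derivable_cst | exact: derivable_bigprod].
Qed.

Definition mx_is_derive (R : numFieldType) (V : normedModType R) (p q : nat)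
    (x v : V) (A : V -> 'M[R]_(p, q)) (dA : 'M[R]_(p, q)) : Prop :=
  forall i j, is_derive x v (fun y => A y i j) (dA i j).

Lemma mx_is_derive_mulmx (R : numFieldType) (V : normedModType R)
    (p q r : nat) (x v : V) (A : V -> 'M[R]_(p, q)) (B : V -> 'M[R]_(q, r)) dA dB :
  mx_is_derive x v A dA -> mx_is_derive x v B dB ->
  mx_is_derive x v (fun y => A y *m B y) (dA *m B x + A x *m dB).
Proof.
move=> hA hB i j.
have -> : (fun y => (A y *m B y) i j)
    = \sum_(k < q) ((fun y => A y i k) * (fun y => B y k j)).
  by apply/funext => y; rewrite mxE fct_sumE.
apply: is_derive_eq.
  by apply: is_derive_sum => k; apply: is_deriveM; [exact: hA | exact: hB].
rewrite !mxE -big_split /=; apply: eq_bigr => k _.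
by rewrite addrC /GRing.scale /= [B x k j * _]mulrC.
Qed.

Lemma mx_is_derive_tr (R : numFieldType) (V : normedModType R)
    (p q : nat) (x v : V) (A : V -> 'M[R]_(p, q)) dA :
  mx_is_derive x v A dA -> mx_is_derive x v (fun y => (A y)^T) dA^T.
Proof.
move=> hA i j; rewrite mxE.
by under eq_fun do rewrite mxE; exact: hA.
Qed.

Lemma near_mx_is_derive (R : numFieldType) (V : normedModType R)
    (p q : nat) (x v : V) (A B : V -> 'M[R]_(p, q)) dA :
  {near x, A =1 B} -> mx_is_derive x v A dA -> mx_is_derive x v B dA.
Proof.
move=> AB hA i j.
apply: (@near_eq_is_derive _ _ _ (fun y => A y i j)); last exact: hA.
by apply: filterS AB => y /= ->.
Qed.

(** Differentiability comes from Cramer's formula; the value is then forced by differentiating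
    [invmx (G y) *m G y = 1]. *)
Lemma mx_is_derive_inv (R : numFieldType) (V : normedModType R)
    (n : nat) (x v : V) (G : V -> 'M[R]_n) dG :
  (\forall y \near x, G y \in unitmx) -> mx_is_derive x v G dG ->
  mx_is_derive x v (fun y => invmx (G y)) (- (invmx (G x) *m dG *m invmx (G x))).
Proof.
move=> Gu hG.
have Gx := nbhs_singleton Gu.
have dG' i j : derivable (fun y => G y i j) x v by case: (hG i j).
pose K y := (\det (G y))^-1 *: \adj (G y).
have GK : {near x, K =1 (fun y => invmx (G y))}.
  by near=> y; rewrite /K /invmx ifT //; near: y.
have dK i j : derivable (fun y => K y i j) x v.
  have -> : (fun y => K y i j) =
      (fun y => (\det (G y))^-1 * ((-1) ^+ (j + i) * \det (row' j (col' i (G y))))).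
    by apply/funext => y; rewrite !mxE.
  apply: derivableM.
    apply: derivableV; last exact: derivable_det.
    by rewrite -unitfE -unitmxE.
  apply: derivableM; first exact: derivable_cst.
  apply: derivable_det => k l; under eq_fun do rewrite !mxE; exact: dG'.
pose D := \matrix_(i, j) 'D_v (fun y => K y i j) x.
have hK : mx_is_derive x v K D.
  by move=> i j; rewrite mxE; exact: derivableP.
have {}hK := near_mx_is_derive GK hK.
suff <- : D = - (invmx (G x) *m dG *m invmx (G x)) by [].
have h1 := mx_is_derive_mulmx hK hG.
have h2 : mx_is_derive x v (fun y => invmx (G y) *m G y) 0.
  apply: (@near_mx_is_derive _ _ _ _ _ _ (fun=> 1%:M)).
    by near=> y; rewrite mulVmx //; near: y.
  by move=> i j; apply: is_derive_eq (is_derive_cst _ _ _) _; rewrite mxE.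
have /eqP : D *m G x + invmx (G x) *m dG = 0.
  apply/matrixP => i j; have := h1 i j; have := h2 i j.
  by move=> [_ <-] [_ <-].
rewrite addr_eq0 => /eqP DG.
by rewrite -[LHS](mulmxK Gx) DG mulNmx.
Unshelve. all: by end_near. Qed.

(** * Riemannian calculus at a point *)

Lemma vec_sqnormE (R : realType) (m : nat) (M : topologicalType)
    (g : riemannian_manifold R m M) (a : chart R m M) (x : M) (v : 'rV[R]_m) :
  vec_sqnorm g a x v = (v *m metric g a x *m v^T) 0 0.
Proof.
rewrite mul_rV_mx_trE; apply: eq_bigr => i _; apply: eq_bigr => j _.
by rewrite [v 0 i * _]mulrC.
Qed.

Lemma covec_sqnormE (R : realType) (m : nat) (M : topologicalType)
    (g : riemannian_manifold R m M) (a : chart R m M) (x : M) (w : 'rV[R]_m) :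
  covec_sqnorm g a x w = (w *m invmx (metric g a x) *m w^T) 0 0.
Proof.
rewrite mul_rV_mx_trE; apply: eq_bigr => i _; apply: eq_bigr => j _.
by rewrite [w 0 i * _]mulrC.
Qed.

Lemma bilin_sqnormE (R : realType) (m : nat) (M : topologicalType)
    (g : riemannian_manifold R m M) (a : chart R m M) (x : M) (T : 'M[R]_m)
    (K := invmx (metric g a x)) :
  K^T = K -> T^T = T -> bilin_sqnorm g a x T = \tr (K *m T *m K *m T).
Proof.
move=> Ks Ts; rewrite mxtrace_mulmxE; apply: eq_bigr => i _.
apply: eq_bigr => j _; rewrite exchange_big /= mxE mulr_suml.
apply: eq_bigr => l _; rewrite mxE !mulr_suml; apply: eq_bigr => k _.
have <- : K j l = K l j by rewrite -{1}Ks mxE.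
by have <- : T i j = T j i by [rewrite -{1}Ts mxE]; rewrite -/K; ring.
Qed.

Lemma christoffelE (R : realType) (m : nat) (M : topologicalType)
    (g : riemannian_manifold R m M) (a : chart R m M) (x : M) (k i j : 'I_m) :
  christoffel g a x k i j =
  chart_christoffel (invmx (metric g a x))
    (fun i => \matrix_(j, l) pderiv a (fun z => metric g a z j l) x i) k i j.
Proof.
rewrite /christoffel /chart_christoffel.
by under [in RHS]eq_bigr do rewrite !mxE.
Qed.

Section PointInChart.
Variables (R : realType) (m : nat) (M : topologicalType).
Variables (g : riemannian_manifold R m M) (a : chart R m M).
Hypothesis atlas_a : atlas g a.

Lemma invmx_metric_sym (z : M) :
  chart_dom a z -> (invmx (metric g a z))^T = invmx (metric g a z).
Proof. by move=> az; apply: invmx_sym; exact: Defs.metric_sym. Qed.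

Lemma metric_unitmx (z : M) : chart_dom a z -> metric g a z \in unitmx.
Proof. by move=> az; apply: posdef_unitmx => v; exact: metric_posdef. Qed.

Lemma gradientE (f : M -> R) (z : M) : chart_dom a z ->
  gradient g a f z = differential a f z *m invmx (metric g a z).
Proof.
move=> az; apply/rowP => j; rewrite !mxE; apply: eq_bigr => i _.
by rewrite -{1}(invmx_metric_sym az) mxE mulrC.
Qed.

Lemma gradient_sqnorm (f : M -> R) (z : M) : chart_dom a z ->
  vec_sqnorm g a z (gradient g a f z) = covec_sqnorm g a z (differential a f z).
Proof.
move=> az; rewrite vec_sqnormE covec_sqnormE gradientE // trmx_mul.
by rewrite invmx_metric_sym // mulmxKV ?metric_unitmx // mulmxA.
Qed.

Variables (Omega : set M) (u : M -> R) (x : M).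
Hypothesis open_Omega : open Omega.
Hypothesis smooth_u : smooth_fun_on g Omega u.
Hypotheses (ax : chart_dom a x) (Omega_x : Omega x).

Let y0 := chart_map a x.
Let img := chart_map a @` (chart_dom a `&` Omega).
Let G y := metric g a (chart_inv a y).
Let w y := differential a u (chart_inv a y).
Let K y := invmx (G y).
Let U := u \o chart_inv a.

Let inv_y0 : chart_inv a y0 = x. Proof. exact: chart_mapK. Qed.

Let img_y0 : img y0. Proof. by exists x. Qed.

Let imgP y : img y ->
  chart_dom a (chart_inv a y) /\ chart_map a (chart_inv a y) = y.
Proof. by case=> z [az _] <-; rewrite chart_mapK. Qed.

(** This is the preimage of [Omega] under [chart_inv], which is continuous on the open image of the
    chart. *)
Lemma open_chart_image : open img.
Proof.
have := @chart_inv_continuous _ _ _ a.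
rewrite continuous_open_subspace; last exact: chart_img_open.
move=> /(continuous_inP _ (@chart_img_open _ _ _ a))/(_ _ open_Omega).
congr open; apply/seteqP; split => [y|y].
  by move=> [[z az <-]] /=; rewrite chart_mapK // => Oz; exists z.
by move=> [z [az Oz] <-]; split; [exists z | rewrite /= chart_mapK].
Qed.

Let near_img : \forall y \near y0, img y.
Proof. exact: open_nbhs_nbhs (conj open_chart_image img_y0). Qed.

Let dG i := \matrix_(j, l) pderiv a (fun z => metric g a z j l) x i.
Let D := \matrix_(i, j) pderiv a (fun z => differential a u z 0 j) x i.

Let G_derive i : mx_is_derive y0 'e_i G (dG i).
Proof.
move=> j l; rewrite mxE; apply: derivableP.
have y0a : (chart_map a @` chart_dom a) y0 by exists x.
by have [_] := metric_smooth j l atlas_a [::] y0a; exact.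
Qed.

(** The chart and its inverse cancel only on the image, so iterated derivatives have to be compared
    through germs at [y0]. *)
Let near_w : \forall y \near y0, forall j, 'D_('e_j) U y = w y 0 j.
Proof.
by apply: filterS near_img => y /imgP[_ yE] j; rewrite mxE /pderiv yE.
Qed.

Let w_derive i : mx_is_derive y0 'e_i w (row i D).
Proof.
move=> k j; rewrite (ord1 k) !mxE; apply: derivableP.
have [_ /(_ i) dU] := smooth_u atlas_a [:: j] img_y0.
by apply: near_eq_derivable dU; apply: filterS near_w => y; exact.
Qed.

Let D_sym : D^T = D.
Proof.
have DE i j : D i j = 'D_('e_i) ('D_('e_j) U) y0.
  by rewrite mxE; apply: near_eq_derive; apply: filterS near_w => y wE; exact/esym.
apply/matrixP => i j; rewrite mxE !DE.
apply: mixed_derive_comm.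
- apply: filterS near_img => y iy; have sm := smooth_u atlas_a.
  split.
  + by have [_ /(_ i)] := sm [::] y iy.
  + by have [_ /(_ j)] := sm [::] y iy.
  + by have [_ /(_ j)] := sm [:: i] y iy.
  + by have [_ /(_ i)] := sm [:: j] y iy.
- by have [] := smooth_u atlas_a [:: j; i] img_y0.
- by have [] := smooth_u atlas_a [:: i; j] img_y0.
Qed.

Let dG_sym i : (dG i)^T = dG i.
Proof.
apply/matrixP => j l; rewrite mxE.
have [_ <-] := G_derive i l j; have [_ <-] := G_derive i j l.
apply: near_eq_derive; apply: filterS near_img => y /imgP[ay _].
by rewrite /G -{1}(Defs.metric_sym atlas_a ay) mxE.
Qed.

Let Ks : (K y0)^T = K y0.
Proof. by rewrite /K /G inv_y0 invmx_metric_sym. Qed.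

Let H := hessian g a u x.
Let v := w y0 *m K y0.

Let HE : H = chart_hessian (K y0) dG D (w y0).
Proof.
apply/matrixP => i j; rewrite !mxE /K /G /w inv_y0; congr (_ - _).
by apply: eq_bigr => k _; rewrite christoffelE.
Qed.

Lemma hessian_sym : (hessian g a u x)^T = hessian g a u x.
Proof. by rewrite -/H HE; exact: chart_hessian_sym. Qed.

Let K_derive i : mx_is_derive y0 'e_i K (- (K y0 *m dG i *m K y0)).
Proof.
apply: mx_is_derive_inv (G_derive i).
by apply: filterS near_img => y /imgP[ay _]; exact: metric_unitmx.
Qed.

Let v_derive i : mx_is_derive y0 'e_i (fun y => w y *m K y)
  (row i D *m K y0 + w y0 *m - (K y0 *m dG i *m K y0)).
Proof. exact: mx_is_derive_mulmx. Qed.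

Let F y := covec_sqnorm g a (chart_inv a y) (w y).

Let F_derive i : is_derive y0 'e_i F (2 * (v *m H) 0 i).
Proof.
have -> : F = (fun y => (w y *m K y *m (w y)^T) 0 0).
  by apply/funext => y; rewrite /F covec_sqnormE.
rewrite -(hessian_sym : H^T = H) HE -chart_derive_sqnorm //.
exact: (mx_is_derive_mulmx (v_derive i) (mx_is_derive_tr (w_derive i))).
Qed.

Lemma differential_sqnorm :
  differential a (fun z => covec_sqnorm g a z (differential a u z)) x
  = 2 *: (differential a u x *m invmx (metric g a x) *m hessian g a u x).
Proof.
apply/rowP => i; rewrite mxE [RHS]mxE.
by have [_] := F_derive i; rewrite /v /w /K /G inv_y0.
Qed.

(** Product rule [div (phi X) = phi div X + d phi (X)] for [X = grad u] and
    [phi = (|du|^2 + eps)^q]; the chain rule and [d|du|^2 = 2 H(grad u, .)] give the second term. *)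
Lemma divergence_regularized (eps q : R) :
  0 < covec_sqnorm g a x (differential a u x) + eps ->
  divergence g a (fun z => (vec_sqnorm g a z (gradient g a u z) + eps) `^ q
                            *: gradient g a u z) x
  = (F y0 + eps) `^ q * \tr (K y0 *m H)
    + 2 * q * (F y0 + eps) `^ (q - 1) * (v *m H *m v^T) 0 0.
Proof.
move=> E0; rewrite /divergence /covariant_vec.
pose X z := (vec_sqnorm g a z (gradient g a u z) + eps) `^ q *: gradient g a u z.
rewrite -/X.
have XE : {near y0, (fun y => (F y + eps) `^ q *: (w y *m K y))
                     =1 (fun y => X (chart_inv a y))}.
  apply: filterS near_img => y /imgP[ay _].
  by rewrite /X gradient_sqnorm // gradientE.
have E0' : 0 < (F \+ cst eps) y0 by rewrite /F /w /= inv_y0.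
have X_derive i : 'D_('e_i) (fun y => X (chart_inv a y) 0 i) y0 =
    (F y0 + eps) `^ q
      * (row i D *m K y0 + w y0 *m - (K y0 *m dG i *m K y0)) 0 i
    + 2 * q * (F y0 + eps) `^ (q - 1) * ((v *m H) 0 i * v 0 i).
  have <- : 'D_('e_i) (fun y => (F y + eps) `^ q * (w y *m K y) 0 i) y0 =
      'D_('e_i) (fun y => X (chart_inv a y) 0 i) y0.
    by apply: near_eq_derive; apply: filterS XE => y <-; rewrite [RHS]mxE.
  have dF := is_deriveD (F_derive i) (@is_derive_cst _ _ _ eps y0 'e_i).
  have dphi := is_derive_powR q E0' dF.
  have [_ ->] := is_deriveM dphi (v_derive i 0 i).
  by rewrite /GRing.scale /= addr0; congr (_ + _); rewrite -/v; ring.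
have X0 k : X x 0 k = (F y0 + eps) `^ q * v 0 k.
  by have := nbhs_singleton XE; rewrite /= inv_y0 => <-; rewrite mxE.
(* The Christoffel terms carry the undifferentiated weight, so they join the derivative of the
   gradient and [chart_divergence] applies. *)
have -> : \tr (\matrix_(i, j) (pderiv a (fun z => X z 0 j) x i
      + \sum_k christoffel g a x j i k * X x 0 k)) =
    \sum_i ((F y0 + eps) `^ q
        * ((row i D *m K y0 + w y0 *m - (K y0 *m dG i *m K y0)) 0 i
           + \sum_k chart_christoffel (K y0) dG i i k * v 0 k)
      + 2 * q * (F y0 + eps) `^ (q - 1) * ((v *m H) 0 i * v 0 i)).
  apply: eq_bigr => i _; rewrite mxE [pderiv _ _ _ _]X_derive mulrDr.
  rewrite addrAC; congr (_ + _ + _); rewrite mulr_sumr.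
  apply: eq_bigr => k _; rewrite christoffelE X0 mulrCA.
  by rewrite /K /G inv_y0.
rewrite big_split /= -!mulr_sumr HE -chart_divergence //; congr (_ + _ * _).
by rewrite [RHS]mxE; apply: eq_bigr => i _; rewrite -HE [v^T i 0]mxE.
Qed.

(** With [E = |du|^2 + eps] and [q = (p - 2) / 2], both terms of the divergence contain the positive
    factor [E^(q - 1)], which cancels; the remaining coefficient is [2 q = p - 2]. *)
Lemma regularized_equation (eps p : R) :
  0 < covec_sqnorm g a x (differential a u x) + eps ->
  divergence g a (fun z => (vec_sqnorm g a z (gradient g a u z) + eps)
                  `^ ((p - 2) / 2) *: gradient g a u z) x = 0 ->
  let w := differential a u x in
  let K := invmx (metric g a x) in
  let H := hessian g a u x in
  ((w *m K *m w^T) 0 0 + eps) * \tr (K *m H)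
    + (p - 2) * (w *m K *m H *m (w *m K)^T) 0 0 = 0.
Proof.
move=> E0; rewrite divergence_regularized //= -covec_sqnormE.
rewrite /F /v /w /K /G inv_y0 -/H.
set E := covec_sqnorm _ _ _ _ + eps in E0 *.
set q := (p - 2) / 2.
have -> : E `^ q = E * E `^ (q - 1).
  rewrite -{2}[E]powRr1 ?ltW // -powRD; first by rewrite addrC subrK.
  by rewrite (gt_eqF E0) implybT.
move=> eqn; have Ep : E `^ (q - 1) != 0 by rewrite gt_eqF // powR_gt0.
apply: (mulfI Ep); rewrite mulr0 -[RHS]eqn mulrDr.
have -> : p - 2 = 2 * q by rewrite /q mulrC divfK.
by congr (_ + _); ring.
Qed.

End PointInChart.

Theorem lemma3p4 (R : realType) (m : nat) (M : topologicalType)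
    (g : riemannian_manifold R m M) (Omega : set M) (eps p : R) (u : M -> R)
    (hOmega : domain Omega) (heps : 0 < eps) (hp : 1 < p)
    (hu : regularized_solution g Omega eps p u) :
  forall (a : chart R m M) (x : M), atlas g a -> chart_dom a x -> Omega x ->
    (covec_sqnorm g a x (differential a u x) + eps)
      * bilin_sqnorm g a x (hessian g a u x)
    >= (1 + kappa2 m p) / 4
       * vec_sqnorm g a x
           (gradient g a
              (fun z => covec_sqnorm g a z (differential a u z)) x).
Proof.
move=> a x aa ax Ox; have [oO _ _] := hOmega; have [su eqn] := hu.
have Gpos : posdef (metric g a x) by move=> v; exact: metric_posdef.
have Gs := Defs.metric_sym aa ax; have Ks := invmx_sym Gs.
have Hs := hessian_sym aa oO su ax Ox.
(* Nonnegativity is read off the gradient, where positive definiteness of the metric itself is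
   available. *)
have F0 : 0 <= covec_sqnorm g a x (differential a u x).
  rewrite -gradient_sqnorm // vec_sqnormE.
  have [->|/Gpos/ltW//] := eqVneq (gradient g a u x) 0.
  by rewrite !mul0mx mxE.
have E0 : 0 < covec_sqnorm g a x (differential a u x) + eps by rewrite ltr_wpDl.
have eq0 := regularized_equation aa oO su ax Ox E0 (eqn a x aa ax Ox).
have := metric_hessian_bound Gs Gpos Hs heps hp eq0.
rewrite bilin_sqnormE // -covec_sqnormE; apply: le_trans.
(* The gradient of [|du|^2] is [2 H v], so its squared norm is [4 |H v|^2]; the 4 cancels the
   denominator and an equality remains. *)
rewrite gradient_sqnorm // covec_sqnormE (differential_sqnorm aa oO su ax Ox).
rewrite -!scalemxAl [(2 *: _)^T]linearZ /= -scalemxAr scalerA mxE mulrA.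
rewrite trmx_mul Hs !mulmxA le_eqVlt; apply/orP; left; apply/eqP.
by congr (_ * _); field.
Qed.
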